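(* Let $\Delta<0$ be real, let $N\ge 0$ be an integer written as $N=2j+p$ with $j$ an integer and $p\in\{0,1\}$, and let $\gamma\in\mathbb R$. For every real $t\neq0$ with $|t|$ sufficiently small, let $\mathcal X,\mathcal Z$ (depending on $t$) be linear operators on a vector space with basis $|n\rangle$, $n=0,1,2,\dots$, satisfying $\mathcal Z\mathcal X-\mathcal X\mathcal Z=\mathcal Z^2+\Delta$, and rescale them as $X=\Omega\mathcal X$, $Z=\Omega\mathcal Z$ with $\Omega=\frac{1}{\sqrt{-\Delta}}$, so that $$ZX-XZ=Z^2-1 .$$ Suppose that $X,Z$ act tridiagonally, $$X|n\rangle=c_n|n-1\rangle+b_n|n\rangle+a_n|n+1\rangle,\qquad Z|n\rangle=u_n|n-1\rangle+v_n|n\rangle+w_n|n+1\rangle,$$ with $c_0=u_0=0$, $c_n,u_n\neq0$ for $n\ge1$ and $a_n,w_n\ne0$ for $n\ge0$, and that the parameters $\delta_0=a_0/w_0$, $\phi_0=c_1/u_1-1$, $v_0$ and $\tilde b_0=b_0-\tfrac12(\delta_0+\phi_0+1)v_0$ are given by $$\phi_0+1=-j+t,\qquad -\delta_0=-j+t+1-p,\qquad v_0=\frac{\gamma+p-1}{-2j+2t-p+1},\qquad \tilde b_0=\tfrac12(N+\gamma-1)$$ (so that the finite-dimensionality condition $N=\delta_0-\phi_0$ holds in the limit $t\to0$). Then the limits $\lim_{t\to0}a_{n-1}c_n$ ($1\le n\le N$) and $\lim_{t\to0}b_n$ ($0\le n\le N$) exist, and the monic polynomials $p_n(x)$, $0\le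 n\le N$, defined by $p_{-1}=0$, $p_0=1$ and $$x\,p_n(x)=p_{n+1}(x)+\Big(\lim_{t\to0}b_n\Big)p_n(x)+\Big(\lim_{t\to0}a_{n-1}c_n\Big)p_{n-1}(x),\qquad 0\le n\le N-1,$$ (the eigenfunctions of $X$ in the finite-dimensional case $N=\delta_0-\phi_0$) are the monic para-Krawtchouk polynomials with parameters $N$ and $\gamma$.
   Context: The monic para-Krawtchouk polynomials $P_n(x)$, $0\le n\le N$, with parameters $N=2j+p$ ($p\in\{0,1\}$) and $\gamma$ are the monic polynomials determined by $P_{-1}=0$, $P_0=1$ and the three-term recurrence $xP_n=P_{n+1}+B_nP_n+U_nP_{n-1}$ with $$U_n=\frac{n(N+1-n)(N-2n+p+\gamma)(N-2n-p+2-\gamma)}{4(2n-N+p-1)(2n-N-p-1)},$$ $$B_n=-\frac{(N-n)(N-2n-2+p+\gamma)}{2(2n-N-p+1)}-\frac{n(N-2n+2-p-\gamma)}{2(2n-N+p-1)}.$$ The term with $p_{n-1}$ (resp. $P_{n-1}$) in the recurrences is understood to be $0$ for $n=0$. In general, for a tridiagonal representation the monic eigenfunctions of $X$ are $p_n=\left(\prod_{i=0}^{n-1}a_i\right)q_n$ with $q_n(x)=\langle x|n\rangle$ for $\langle x|X=x\langle x|$, $q_0=1$, and satisfy $xp_n=p_{n+1}+b_np_n+a_{n-1}c_np_{n-1}$. For a representation as in the claim, $c_n/u_n=\phi_0+n$ for $n\ge1$ and $a_n/w_n=\delta_0-n$ for $n\ge0$. Since setting $N=\delta_0-\phi_0$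 directly gives singular expressions for the representation coefficients, the eigenfunctions of $X$ in this case are by convention those obtained from the limit $t\to0$ of the recurrence coefficients. The subscript-free $p\in\{0,1\}$ is the parity of $N$ and is unrelated to the polynomials $p_n$. *)

(* Defs.v *)
From HB Require Import structures.
From mathcomp Require Import all_boot all_order all_algebra.
From mathcomp Require Import all_classical all_reals all_analysis.

Set Implicit Arguments.
Unset Strict Implicit.
Unset Printing Implicit Defensive.

Import Order.TTheory GRing.Theory Num.Theory.
Import numFieldNormedType.Exports.

Local Open Scope classical_set_scope.
Local Open Scope ring_scope.

(* The coefficient [u 0] plays no role: the term in [p_(n-1)] is read as 0
   for n = 0.  See [monic_ttrE] for the usual form of the recurrence. *)
Fixpoint monic_ttr (F : fieldType) (b u : nat -> F) (n : nat) : {poly F} :=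
  match n with
  | 0 => 1
  | m.+1 => ('X - (b m)%:P) * monic_ttr b u m
            - match m with
              | 0 => 0
              | k.+1 => u m *: monic_ttr b u k
              end
  end.

Lemma monic_ttrE (F : fieldType) (b u : nat -> F) (n : nat) :
  'X * monic_ttr b u n =
    monic_ttr b u n.+1 + b n *: monic_ttr b u n
    + (if n is k.+1 then u n *: monic_ttr b u k else 0).
Proof.
case: n => [|n]; first by rewrite /= !mulr1 subr0 addr0 alg_polyC subrK.
have -> : monic_ttr b u n.+2 = ('X - (b n.+1)%:P) * monic_ttr b u n.+1
                               - u n.+1 *: monic_ttr b u n by [].
by rewrite mulrBl mul_polyC [RHS]addrAC !subrK.
Qed.

(* As N and p have the same parity, no denominator below vanishes when
   p is 0 or 1. *)
Definition paraK_U (F : fieldType) (N p : nat) (gamma : F) (n : nat) : F :=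
  (n%:R * (N%:R + 1 - n%:R) * (N%:R - 2 * n%:R + p%:R + gamma)
     * (N%:R - 2 * n%:R - p%:R + 2 - gamma))
  / (4 * (2 * n%:R - N%:R + p%:R - 1) * (2 * n%:R - N%:R - p%:R - 1)).

Definition paraK_B (F : fieldType) (N p : nat) (gamma : F) (n : nat) : F :=
  - (((N%:R - n%:R) * (N%:R - 2 * n%:R - 2 + p%:R + gamma))
     / (2 * (2 * n%:R - N%:R - p%:R + 1)))
  - (n%:R * (N%:R - 2 * n%:R + 2 - p%:R - gamma))
     / (2 * (2 * n%:R - N%:R + p%:R - 1)).

Definition paraKrawtchouk (F : fieldType) (N p : nat) (gamma : F) (n : nat) :
  {poly F} := monic_ttr (paraK_B N p gamma) (paraK_U N p gamma) n.

(* Algebraic (Hamel) basis indexed by nat. *)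
Definition is_basis (K : fieldType) (V : lmodType K) (e : nat -> V) : Prop :=
  (forall (m : nat) (l : nat -> K),
     \sum_(i < m) l i *: e i = 0 -> forall i, (i < m)%N -> l i = 0) /\
  (forall x : V, exists (m : nat) (l : nat -> K), x = \sum_(i < m) l i *: e i).

(* X|n> = c_n |n-1> + b_n |n> + a_n |n+1>; at n = 0 the first term vanishes
   because c_0 = 0 is required, whatever e 0.-1 denotes. *)
Definition tridiagonal (K : fieldType) (V : lmodType K) (e : nat -> V)
    (X : V -> V) (a b c : nat -> K) : Prop :=
  [/\ c 0%N = 0,
      forall n, (1 <= n)%N -> c n != 0,
      forall n, a n != 0 &
      forall n, X (e n) = c n *: e n.-1 + b n *: e n + a n *: e n.+1].

Definition delta0 (K : fieldType) (a w : nat -> K) : K := a 0%N / w 0%N.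

Definition phi0 (K : fieldType) (c u : nat -> K) : K := c 1%N / u 1%N - 1.

Definition btilde0 (K : fieldType) (a b c u v w : nat -> K) : K :=
  b 0%N - 2^-1 * (delta0 a w + phi0 c u + 1) * v 0%N.

Definition Omega (R : realType) (Delta : R) : R := 1 / Num.sqrt (- Delta).

(* Main.v *)
(* Comparing coefficients in [ZX - XZ = Z^2 - 1] gives
   [a_n = (delta_0 - n) w_n], [c_n = (phi_0 + n) u_n] and first-order
   recurrences for [v_n], [b_n] and [r_n = w_(n-1) u_n].  With
   [D = delta_0 - phi_0 = N - 2t] and [g = gamma + p - 1] they are solved by
     [v_n = v_0 (D^2 - 1) / ((D - 2n)^2 - 1)],
     [b_n = btilde_0 + (p - 1) v_n / 2],
     [r_n = n (D - n + 1) (g^2 - (D - 2n + 1)^2)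
            / ((D - 2n) (D - 2n + 2) (D - 2n + 1)^2)],
   where [D] is not an integer for small [t <> 0], so nothing vanishes.  The
   factors [(delta_0 - n + 1) (phi_0 + n)] of [a_(n-1) c_n] cancel exactly the
   denominators of [r_n] that vanish at [t = 0], leaving the para-Krawtchouk
   coefficients with [N] replaced by [D] (plus [t] for [b_n]), which are
   continuous at [t = 0]. *)

Require Import Defs.
From HB Require Import structures.
From mathcomp Require Import all_boot all_order all_algebra.
From mathcomp Require Import all_classical all_reals all_analysis.
From mathcomp Require Import ring lra zify.

Set Implicit Arguments.
Unset Strict Implicit.
Unset Printing Implicit Defensive.

Import Order.TTheory GRing.Theory Num.Theory.
Import numFieldNormedType.Exports.

Local Open Scope classical_set_scope.
Local Open Scope ring_scope.

(* [paraK_U] and [paraK_B] with the natural number [N] replaced by a scalar. *)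
Definition paraK_U_at (F : fieldType) (x : F) (p : nat) (gamma : F) (n : nat)
    : F :=
  (n%:R * (x + 1 - n%:R) * (x - 2 * n%:R + p%:R + gamma)
     * (x - 2 * n%:R - p%:R + 2 - gamma))
  / (4 * (2 * n%:R - x + p%:R - 1) * (2 * n%:R - x - p%:R - 1)).

Definition paraK_B_at (F : fieldType) (x : F) (p : nat) (gamma : F) (n : nat)
    : F :=
  - (((x - n%:R) * (x - 2 * n%:R - 2 + p%:R + gamma))
     / (2 * (2 * n%:R - x - p%:R + 1)))
  - (n%:R * (x - 2 * n%:R + 2 - p%:R - gamma))
     / (2 * (2 * n%:R - x + p%:R - 1)).

(** * Coordinate functionals of a Hamel basis *)

(** These dual functionals turn the operator identity into scalar equations. Choice picks one finite
    expansion per vector; padding with zeros makes expansions of different lengths comparable, and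
    independence makes coefficients unique, hence linear in the vector. *)
Lemma basis_coord (K : fieldType) (V : lmodType K) (e : nat -> V) :
  is_basis e ->
  exists f : nat -> V -> K,
    (forall k l x y, f k (l *: x + y) = l * f k x + f k y) /\
    (forall k i, f k (e i) = (i == k)%:R).
Proof.
move=> [indep span].
pose trunc m (l : nat -> K) i := if (i < m)%N then l i else 0.
have truncE m l M : (m <= M)%N ->
    \sum_(i < m) l (nat_of_ord i) *: e i = \sum_(i < M) trunc m l (nat_of_ord i) *: e i.
  move=> mM; rewrite (big_ord_widen M (fun i => l i *: e i)) // big_mkcond /=.
  by apply: eq_bigr => i _; rewrite /trunc; case: ifP => // _; rewrite scale0r.
(* The expansion is required to hold at every length beyond a bound, so that two vectors can later
   be expanded over a common range. *)
have coordP x : exists g : nat * (nat -> K),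
    forall M, (g.1 <= M)%N ->
      x = \sum_(i < M) g.2 i *: e i /\ forall i, (M <= i)%N -> g.2 i = 0.
  have [m [l xE]] := span x; exists (m, trunc m l) => M /= mM.
  split=> [|i Mi]; first by rewrite xE; exact: truncE.
  by rewrite /trunc ltnNge (leq_trans mM Mi).
have [g gP] := choice coordP.
have uniq x (l : nat -> K) M : x = \sum_(i < M) l i *: e i ->
    (forall i, (M <= i)%N -> l i = 0) -> forall k, (g x).2 k = l k.
  move=> xE l0 k.
  pose M' := maxn M (g x).1.
  have [|xE' g0] := gP x M'; first exact: leq_maxr.
  have xE'' : x = \sum_(i < M') l i *: e i.
    rewrite xE (truncE _ _ M') ?leq_maxl //; apply: eq_bigr => i _.
    by rewrite /trunc; case: ltnP => // /l0 ->.
  have [kM|Mk] := ltnP k M'; last first.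
    by rewrite g0 // l0 // (leq_trans _ Mk) // leq_maxl.
  apply/eqP; rewrite -subr_eq0; apply/eqP.
  apply: (indep M' (fun i => (g x).2 i - l i)) kM.
  under eq_bigr do rewrite scalerBl.
  by rewrite big_split /= sumrN -xE' -xE'' subrr.
exists (fun k x => (g x).2 k); split=> [k l x y|k i].
  pose M := maxn (g x).1 (g y).1.
  have [|xE x0] := gP x M; first exact: leq_maxl.
  have [|yE y0] := gP y M; first exact: leq_maxr.
  apply: (uniq _ (fun k => l * (g x).2 k + (g y).2 k) M) => [|i Mi].
    rewrite {1}xE {1}yE scaler_sumr -big_split /=.
    by apply: eq_bigr => i _; rewrite scalerDl scalerA.
  by rewrite x0 // y0 // mulr0 addr0.
apply: (uniq _ (fun k => (i == k)%:R) i.+1) => [|m im]; last first.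
  by rewrite ltn_eqF.
rewrite big_ord_recr /= eqxx scale1r big1 ?add0r // => m _.
by rewrite gtn_eqF // scale0r.
Qed.

(** * Recurrences forced by the commutation relation *)

Section Representation.

Variables (K : numFieldType) (V : lmodType K) (e : nat -> V).
Variables (X Z : {linear V -> V}) (a b c u v w : nat -> K).
Hypothesis e_basis : is_basis e.
Hypothesis XZ : forall x, Z (X x) - X (Z x) = Z (Z x) - x.
Hypothesis X_tri : tridiagonal e X a b c.
Hypothesis Z_tri : tridiagonal e Z w v u.

Let coord_tri2 (Y Y' : {linear V -> V}) (a1 b1 c1 a2 b2 c2 : nat -> K)
    (f : nat -> V -> K) :
  (forall k l x y, f k (l *: x + y) = l * f k x + f k y) ->
  (forall k i, f k (e i) = (i == k)%:R) ->
  tridiagonal e Y a1 b1 c1 -> tridiagonal e Y' a2 b2 c2 ->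
  forall n k, f k (Y (Y' (e n))) =
    c2 n * (c1 n.-1 * (n.-2 == k)%:R + b1 n.-1 * (n.-1 == k)%:R
            + a1 n.-1 * (n == k)%:R)
    + b2 n * (c1 n * (n.-1 == k)%:R + b1 n * (n == k)%:R
            + a1 n * (n.+1 == k)%:R)
    + a2 n * (c1 n.+1 * (n == k)%:R + b1 n.+1 * (n.+1 == k)%:R
            + a1 n.+1 * (n.+2 == k)%:R).
Proof.
move=> fL fe [c10 _ _ YE] [c20 _ _ Y'E] n k.
have f0 : f k 0 = 0.
  have := fL k 1 0 0; rewrite scaler0 addr0 mul1r => /eqP.
  by rewrite -subr_eq0 opprD addrA subrr sub0r oppr_eq0 => /eqP.
have fD x y : f k (x + y) = f k x + f k y.
  by rewrite -[x]scale1r fL mul1r scale1r.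
have fZ l x : f k (l *: x) = l * f k x by rewrite -[l *: x]addr0 fL f0 addr0.
rewrite Y'E !linearD !linearZ /= !YE !(fD, fZ) !fe /=.
(* The last index [n] of the first line stands for [n.-1.+1]; these differ only at [n = 0], where
   [c2 0 = 0]. *)
by case: n => [|n]; rewrite ?c20 ?mul0r.
Qed.

(** Apply the relation to [e n] and read off coordinates: two steps up or down shows that
    [a n / w n] drops by 1 and [c n / u n] grows by 1; one step up or down gives the two formulas
    for [b n.+1 - b n]; the diagonal gives the recurrence for [w n * u n.+1]. *)
Lemma tridiagonal_recurrences :
  [/\ forall n, a n = (delta0 a w - n%:R) * w n,
      forall n, c n.+1 = (phi0 c u + n.+1%:R) * u n.+1,
      forall n, b n.+1 - b n = (delta0 a w - n%:R - 1) * v n.+1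
                               - (delta0 a w - n%:R + 1) * v n,
      forall n, b n.+1 - b n = (phi0 c u + n.+1%:R + 1) * v n.+1
                               - (phi0 c u + n.+1%:R - 1) * v n &
      forall n, (delta0 a w - phi0 c u - 2 * n%:R - 2) * (w n * u n.+1)
        = (delta0 a w - phi0 c u - 2 * n%:R + 2)
            * (if n is m.+1 then w m * u n else 0) + v n ^+ 2 - 1].
Proof.
have [f [fL fe]] := basis_coord e_basis.
have main n k : f k (Z (X (e n))) - f k (X (Z (e n)))
                = f k (Z (Z (e n))) - (n == k)%:R.
  have fB x y : f k (x - y) = f k x - f k y.
    by rewrite addrC -scaleN1r fL mulN1r addrC.
  by rewrite -fB XZ fB fe.
have neq (m : nat) : (((m == m.+1) = false) * ((m.+1 == m) = false)
    * ((m == m.+2) = false) * ((m.+2 == m) = false)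
    * ((m == m.+3) = false) * ((m.+3 == m) = false)
    * ((m == m.+4) = false) * ((m.+4 == m) = false))%type.
  by do !split; lia.
have [u0 u_neq0 w_neq0 _] := Z_tri; have [c0 _ _ _] := X_tri.
have expand n k := (coord_tri2 fL fe Z_tri X_tri n k,
                    coord_tri2 fL fe X_tri Z_tri n k,
                    coord_tri2 fL fe Z_tri Z_tri n k).
have simp := (eqxx, neq, c0, u0, mulr0, mul0r, mulr1, add0r, addr0, subr0).
have aE n : a n = (delta0 a w - n%:R) * w n.
  elim: n => [|n IHn]; first by rewrite subr0 divfK.
  have := main n n.+2; rewrite !expand.
  have -> : (n.-2 == n.+2) = false by lia.
  have -> : (n.-1 == n.+2) = false by lia.
  rewrite !simp IHn => E; apply: (mulfI (w_neq0 n)).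
  rewrite -[LHS](subKr ((delta0 a w - n%:R) * w n * w n.+1)) E; ring.
have cE n : c n.+1 = (phi0 c u + n.+1%:R) * u n.+1.
  elim: n => [|n IHn]; first by rewrite subrK divfK ?u_neq0.
  have := main n.+2 n; rewrite !expand /=.
  rewrite !simp IHn => E; apply: (mulIf (u_neq0 n.+1 isT)).
  apply: (addIr (- (u n.+2 * ((phi0 c u + n.+1%:R) * u n.+1)))).
  rewrite E; ring.
split=> // n.
- have := main n n.+1; rewrite !expand.
  have -> : (n.-2 == n.+1) = false by lia.
  have -> : (n.-1 == n.+1) = false by lia.
  rewrite !simp !aE => E; apply: (mulfI (w_neq0 n)).
  apply/eqP; rewrite -subr_eq0; apply/eqP.
  move: E => /eqP; rewrite -subr_eq0 => /eqP E.
  rewrite -[RHS]oppr0 -E; ring.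
- have := main n.+1 n; rewrite !expand /=.
  (* At [n = 0] truncated subtraction makes [n.-1 == n] true, but the coefficients it multiplies are
     then [c 0] and [u 0]. *)
  have kill (x : nat -> K) : x 0%N = 0 -> x n * (n.-1 == n)%:R = 0.
    by case: n {expand} => [|n] x0; rewrite ?x0 ?mul0r //= neq mulr0.
  rewrite !(kill _ c0, kill _ u0) !simp cE => E; apply: (mulfI (u_neq0 n.+1 isT)).
  apply/eqP; rewrite -subr_eq0; apply/eqP.
  move: E => /eqP; rewrite -subr_eq0 => /eqP E.
  rewrite -E; ring.
case: n => [|n].
  have := main 0%N 0%N; rewrite !expand /= !simp !aE !cE.
  move=> /eqP; rewrite -subr_eq0 => /eqP E.
  apply/eqP; rewrite -subr_eq0; apply/eqP.
  rewrite -E; ring.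
have := main n.+1 n.+1; rewrite !expand /=.
have -> : (n.-1 == n.+1) = false by lia.
rewrite !simp !aE !cE /=.
move=> /eqP; rewrite -subr_eq0 => /eqP E.
apply/eqP; rewrite -subr_eq0; apply/eqP.
rewrite -E; ring.
Qed.

End Representation.

(** * Solving the recurrences for non-integral [D] *)

Section ClosedForms.

Variables (K : numFieldType) (D : K).
Hypothesis D_nint : forall k : int, D != k%:~R.

Let D_neq (m q : nat) (x : K) : x = D - m%:R + q%:R -> x != 0.
Proof.
move=> ->; have := D_nint (m%:Z - q%:Z).
by rewrite rmorphB /= -subr_eq0 opprB addrA addrAC.
Qed.

(** Multiplying the recurrence by [D - 2 n - 1] shows that [(D - 2 n + 1) (D - 2 n - 1) v_n] does
    not depend on [n]. *)
Lemma v_closed_form (v : nat -> K) :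
  (forall n, (D - 2 * n%:R - 3) * v n.+1 = (D - 2 * n%:R + 1) * v n) ->
  forall n, v n = v 0%N * (D + 1) * (D - 1)
                  / ((D - 2 * n%:R + 1) * (D - 2 * n%:R - 1)).
Proof.
move=> rec; have Dp : D + 1 != 0 by apply: (@D_neq 0 1); ring.
have Dm : D - 1 != 0 by apply: (@D_neq 1 0); ring.
elim=> [|n IHn]; first by field; rewrite Dp Dm.
have h1 : D - 2 * n%:R + 1 != 0 by apply: (@D_neq (2 * n) 1); ring.
have h2 : D - 2 * (1 + n%:R) + 1 != 0 by apply: (@D_neq (2 * n + 1) 0); ring.
have h3 : D - 2 * (1 + n%:R) - 1 != 0 by apply: (@D_neq (2 * n + 3) 0); ring.
have h4 : D - 2 * n%:R - 3 != 0 by apply: (@D_neq (2 * n + 3) 0); ring.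
by apply: (mulfI h4); rewrite rec IHn; field; rewrite h1 h2 h3.
Qed.

(* Multiplied by [D - 2 n], the recurrence telescopes: with [s = D - 2 n],
   [4 s / (s ^+ 2 - 1) ^+ 2 = 1 / (s - 1) ^+ 2 - 1 / (s + 1) ^+ 2]. *)
Lemma r_closed_form (v r : nat -> K) (g : K) : v 0%N * (D - 1) = - g ->
  (forall n, v n = v 0%N * (D + 1) * (D - 1)
                  / ((D - 2 * n%:R + 1) * (D - 2 * n%:R - 1))) ->
  r 0%N = 0 ->
  (forall n, (D - 2 * n%:R - 2) * r n.+1
             = (D - 2 * n%:R + 2) * r n + v n ^+ 2 - 1) ->
  forall n, r n = n%:R * (D - n%:R + 1) * (g ^+ 2 - (D - 2 * n%:R + 1) ^+ 2)
    / ((D - 2 * n%:R) * (D - 2 * n%:R + 2) * (D - 2 * n%:R + 1) ^+ 2).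
Proof.
move=> v0E vE r0 rec; elim=> [|n IHn]; first by rewrite r0 !mul0r.
have h1 : D - 2 * n%:R + 1 != 0 by apply: (@D_neq (2 * n) 1); ring.
have h2 : D - 2 * (1 + n%:R) + 1 != 0 by apply: (@D_neq (2 * n + 1) 0); ring.
have h3 : D - 2 * n%:R + 2 != 0 by apply: (@D_neq (2 * n) 2); ring.
have h4 : D - 2 * (1 + n%:R) + 2 != 0 by apply: (@D_neq (2 * n) 0); ring.
have h5 : D - 2 * (1 + n%:R) != 0 by apply: (@D_neq (2 * n + 2) 0); ring.
have h6 : D - 2 * n%:R - 2 != 0 by apply: (@D_neq (2 * n + 2) 0); ring.
apply: (mulfI h6); rewrite rec IHn vE (mulrAC (v 0%N)) v0E.
by field; rewrite h1 h2 h3 h4 h5.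
Qed.

Variables (V : lmodType K) (e : nat -> V) (X Z : {linear V -> V}).
Variables (a b c u v w : nat -> K).
Hypothesis e_basis : is_basis e.
Hypothesis XZ : forall x, Z (X x) - X (Z x) = Z (Z x) - x.
Hypothesis X_tri : tridiagonal e X a b c.
Hypothesis Z_tri : tridiagonal e Z w v u.

Lemma tridiagonal_closed_form (p : nat) (gamma J t : K) :
  p = 0%N \/ p = 1%N -> D = 2 * J + p%:R - 2 * t ->
  phi0 c u + 1 = - J + t -> - delta0 a w = - J + t + 1 - p%:R ->
  v 0%N = (gamma + p%:R - 1) / (- 2 * J + 2 * t - p%:R + 1) ->
  btilde0 a b c u v w = 2^-1 * (2 * J + p%:R + gamma - 1) ->
  (forall n, a n * c n.+1 = paraK_U_at D p gamma n.+1) /\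
  (forall n, b n = paraK_B_at D p gamma n + t).
Proof.
move=> p01 DE phiE deltaE v0E btE.
have [aE cE b1 b2 r_rec] := tridiagonal_recurrences e_basis XZ X_tri Z_tri.
have phi : phi0 c u = - (D - p%:R) / 2 - 1.
  by rewrite -[LHS](addrK 1) phiE DE; field.
have delta : delta0 a w = (D + p%:R) / 2 - 1.
  by rewrite -[LHS]opprK deltaE DE; field.
have Dm : D - 1 != 0 by apply: (@D_neq 1 0); ring.
have Dp : D + 1 != 0 by apply: (@D_neq 0 1); ring.
have v0D : v 0%N * (D - 1) = - (gamma + p%:R - 1).
  rewrite v0E (_ : - 2 * J + 2 * t - p%:R + 1 = - (D - 1)); last first.
    by rewrite DE; ring.
  by rewrite invrN mulrN mulNr divfK.
(* Equating the two expressions for [b n.+1 - b n] eliminates [b]. *)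
have vrec n : (D - 2 * n%:R - 3) * v n.+1 = (D - 2 * n%:R + 1) * v n.
  have := b2 n; rewrite b1 phi delta => /eqP.
  rewrite -subr_eq0 => /eqP E; apply/eqP; rewrite -subr_eq0; apply/eqP.
  by rewrite -[RHS]E; field.
have vE := v_closed_form vrec.
pose r n := if n is m.+1 then w m * u n else 0.
have rrec n : (D - 2 * n%:R - 2) * r n.+1
              = (D - 2 * n%:R + 2) * r n + v n ^+ 2 - 1.
  have := r_rec n; rewrite phi delta /r.
  by rewrite (_ : (D + p%:R) / 2 - 1 - (- (D - p%:R) / 2 - 1) = D) //; field.
have rE := r_closed_form v0D vE erefl rrec.
(* Since [delta0 - n - 1 = (D - 2 n - 3 + (p - 1)) / 2] and [delta0 - n + 1 = (D - 2 n + 1 + (p -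
   1)) / 2], the parts without [p - 1] cancel by [vrec]. *)
have bE n : b n = b 0%N + (p%:R - 1) / 2 * (v n - v 0%N).
  elim: n => [|n IHn]; first by rewrite subrr mulr0 addr0.
  have h1 : D - 2 * n%:R + 1 != 0 by apply: (@D_neq (2 * n) 1); ring.
  have h3 : D - 2 * (1 + n%:R) + 1 != 0 by apply: (@D_neq (2 * n + 1) 0); ring.
  have h4 : D - 2 * (1 + n%:R) - 1 != 0 by apply: (@D_neq (2 * n + 3) 0); ring.
  rewrite -[LHS](subrK (b n)) b1 delta IHn vE [v n]vE.
  by field; rewrite h1 h3 h4.
(* The lone [t] appears because [btilde0] is given through [N = D + 2 t] and not through [D]. *)
have b0E : b 0%N = (D + gamma - 1) / 2 + t + (p%:R - 1) / 2 * v 0%N.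
  rewrite -[LHS](subrK (2^-1 * (delta0 a w + phi0 c u + 1) * v 0%N)).
  have := btE; rewrite /btilde0 => ->; rewrite phi delta DE; by field.
split=> n.
  rewrite aE cE phi delta.
  rewrite (_ : _ * _ = ((D + p%:R) / 2 - 1 - n%:R)
                       * (- (D - p%:R) / 2 - 1 + n.+1%:R) * r n.+1); last first.
    by rewrite /r; ring.
  rewrite rE /paraK_U_at.
  have h1 : D - 2 * (1 + n%:R) != 0 by apply: (@D_neq (2 * n + 2) 0); ring.
  have h2 : D - 2 * (1 + n%:R) + 1 != 0 by apply: (@D_neq (2 * n + 1) 0); ring.
  have h3 : D - 2 * (1 + n%:R) + 2 != 0 by apply: (@D_neq (2 * n) 0); ring.
  have h4 : 2 * (1 + n%:R) - D - 1 != 0.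
    by rewrite -oppr_eq0; apply: (@D_neq (2 * n + 1) 0); ring.
  have h5 : 2 * (1 + n%:R) - D - 1 - 1 != 0.
    by rewrite -oppr_eq0; apply: (@D_neq (2 * n) 0); ring.
  have h6 : 2 * (1 + n%:R) - D + 1 - 1 != 0.
    by rewrite -oppr_eq0; apply: (@D_neq (2 * n + 2) 0); ring.
  (* With [m = n + 1], the prefactor is [- (D - 2 m) (D - 2 m + 2) / 4] for [p = 0] and
     [- (D - 2 m + 1) ^+ 2 / 4] for [p = 1]. Each cancels one part of the denominator of [r m]; its
     sign matches the factorization of [g ^+ 2 - (D - 2 m + 1) ^+ 2]. *)
  by case: p01 => ->; field; rewrite h1 h2 h3 ?h4 ?h5 ?h6.
rewrite bE b0E /paraK_B_at [v n]vE (mulrAC (v 0%N)) v0D.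
have h1 : D - 2 * n%:R - 1 != 0 by apply: (@D_neq (2 * n + 1) 0); ring.
have h2 : D - 2 * n%:R + 1 != 0 by apply: (@D_neq (2 * n) 1); ring.
have h3 : 2 * n%:R - D - 1 != 0.
  by rewrite -oppr_eq0; apply: (@D_neq (2 * n) 1); ring.
have h4 : 2 * n%:R - D + 1 != 0.
  by rewrite -oppr_eq0; apply: (@D_neq (2 * n + 1) 0); ring.
have h5 : 2 * n%:R - D + 1 - 1 != 0.
  by rewrite -oppr_eq0; apply: (@D_neq (2 * n) 0); ring.
by case: p01 => ->; field; rewrite h1 h2 ?h3 ?h4 ?h5.
Qed.

End ClosedForms.

(** * Compatibility with field morphisms, and locality of the three-term recurrence *)

Lemma rmorph_paraK_U (F F' : fieldType) (f : {rmorphism F -> F'}) (x : F)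
    (p : nat) (gamma : F) (n : nat) :
  f (paraK_U_at x p gamma n) = paraK_U_at (f x) p (f gamma) n.
Proof.
by rewrite /paraK_U_at !(fmorphV, rmorphM, rmorphD, rmorphN, rmorph_nat, rmorph1).
Qed.

Lemma rmorph_paraK_B (F F' : fieldType) (f : {rmorphism F -> F'}) (x : F)
    (p : nat) (gamma : F) (n : nat) :
  f (paraK_B_at x p gamma n) = paraK_B_at (f x) p (f gamma) n.
Proof.
by rewrite /paraK_B_at !(fmorphV, rmorphM, rmorphD, rmorphN, rmorph_nat, rmorph1).
Qed.

Lemma monic_ttrSS (F : fieldType) (b u : nat -> F) (n : nat) :
  monic_ttr b u n.+2 =
    ('X - (b n.+1)%:P) * monic_ttr b u n.+1 - u n.+1 *: monic_ttr b u n.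
Proof. by []. Qed.

Lemma eq_monic_ttr (F : fieldType) (b b' u u' : nat -> F) (n : nat) :
  (forall m, (m < n)%N -> b m = b' m) ->
  (forall m, (0 < m < n)%N -> u m = u' m) ->
  monic_ttr b u n = monic_ttr b' u' n.
Proof.
elim/ltn_ind: n => -[|[|n]] IH bE uE; first by [].
  by rewrite /= bE.
rewrite !monic_ttrSS bE ?uE ?ltnSn // !IH // => m h.
- by apply: bE; lia.
- by apply: uE; lia.
- by apply: bE; lia.
- by apply: uE; lia.
Qed.

Lemma map_monic_ttr (F F' : fieldType) (f : {rmorphism F -> F'})
    (b u : nat -> F) (n : nat) :
  map_poly f (monic_ttr b u n) = monic_ttr (f \o b) (f \o u) n.
Proof.
elim/ltn_ind: n => -[|[|n]] IH; first by rewrite /= rmorph1.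
  by rewrite /= !mulr1 !subr0 rmorphB /= map_polyX map_polyC.
rewrite !monic_ttrSS -!IH //.
by rewrite rmorphB rmorphM rmorphB /= map_polyX map_polyC map_polyZ.
Qed.

(** * Rescaling, and genericity of [N - 2 t] *)

(** Scaling both operators by [Omega] multiplies the quadratic relation by [Omega ^+ 2], which turns
    its constant term into -1. *)
Lemma Omega_sqr (R : realType) (Delta : R) :
  Delta < 0 -> Omega Delta ^+ 2 * Delta = -1.
Proof.
move=> D0; rewrite /Omega div1r exprVn sqr_sqrtr ?oppr_ge0 ?ltW //.
by rewrite invrN mulNr mulVf ?lt_eqF.
Qed.

(** One punctured neighbourhood serves all [k]: for [0 < |t| < 1/2], an integral [2 t] would be a
    nonzero integer of absolute value less than 1. *)
Lemma near0_shift_nint (R : realType) (N : nat) :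
  \forall t \near (0 : R)^', forall k : int, N%:R - 2 * t != k%:~R.
Proof.
near=> t => k.
have t0 : t != 0 by near: t; exact: nbhs_dnbhs_neq.
have t1 : `|t| < 2^-1.
  by near: t; apply: dnbhs0_lt; rewrite invr_gt0.
apply/eqP => E.
have E' : 2 * t = (N%:Z - k)%:~R by rewrite rmorphB /= -E; ring.
have : `|(N%:Z - k)%:~R| < 1 :> R.
  rewrite -E' normrM ger0_norm //; lra.
rewrite -intr_norm ltrz1 => k0.
have Nk : N%:Z - k = 0 by lia.
by move: E'; rewrite Nk => /eqP; rewrite mulf_eq0 (negbTE t0) pnatr_eq0.
Unshelve. all: by end_near.
Qed.

(** * Continuity of the para-Krawtchouk coefficients at [t = 0] *)

Section ParaKrawtchoukLimits.

Variables (R : realType) (N p : nat) (j : int).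
Hypothesis Njp : N%:Z = 2 * j + p%:Z.

Let NR : N%:R = 2 * j%:~R + p%:R :> R.
Proof. by have /(congr1 (fun z : int => z%:~R : R)) := Njp; rewrite rmorphD rmorphM. Qed.

(** As [N - p] is even, every denominator at [t = 0] is a nonzero constant times odd integers. *)
Let odd_neq0 (m : int) (x : R) : x = 2 * m%:~R + 1 -> x != 0.
Proof.
move=> ->; rewrite (_ : _ + _ = (2 * m + 1)%:~R); last by rewrite rmorphD rmorphM.
by rewrite intr_eq0; lia.
Qed.

(** Every factor of the coefficients at [N - 2 t] is affine in [t]; the values of [k] supplied below
    are the slopes. *)
Let affine_cvg (k l : R) (h : R -> R) :
  (forall t, h t = l + k * t) -> h t @[t --> (0 : R)^'] --> l.
Proof.
move=> /funext ->; rewrite -[X in _ --> X]addr0 -[X in _ --> _ + X](mulr0 k).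
by apply: cvgD; [exact: cvg_cst | apply: cvgMr; exact: nbhs_dnbhs].
Qed.

Lemma paraK_U_cvg (gamma : R) (n : nat) :
  paraK_U_at (N%:R - 2 * t) p gamma n @[t --> (0 : R)^']
    --> paraK_U N p gamma n.
Proof.
have h1 : 2 * n%:R - N%:R + p%:R - 1 != 0 :> R.
  by apply: (@odd_neq0 (n%:Z - j - 1)); rewrite NR rmorphB rmorphB /=; ring.
have h2 : 2 * n%:R - N%:R - p%:R - 1 != 0 :> R.
  apply: (@odd_neq0 (n%:Z - j - p%:Z - 1)).
  by rewrite NR rmorphB rmorphB rmorphB /=; ring.
apply: cvgM; last first.
  apply: cvgV; first by rewrite !mulf_neq0.
  apply: cvgM; last by apply: (affine_cvg (k := 2)) => t; ring.
  by apply: (affine_cvg (k := 8)) => t; ring.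
apply: cvgM; last by apply: (affine_cvg (k := -2)) => t; ring.
apply: cvgM; last by apply: (affine_cvg (k := -2)) => t; ring.
by apply: (affine_cvg (k := -2 * n%:R)) => t; ring.
Qed.

Lemma paraK_B_cvg (gamma : R) (n : nat) :
  paraK_B_at (N%:R - 2 * t) p gamma n + t @[t --> (0 : R)^']
    --> paraK_B N p gamma n.
Proof.
have h1 : 2 * n%:R - N%:R - p%:R + 1 != 0 :> R.
  by apply: (@odd_neq0 (n%:Z - j - p%:Z)); rewrite NR rmorphB rmorphB /=; ring.
have h2 : 2 * n%:R - N%:R + p%:R - 1 != 0 :> R.
  by apply: (@odd_neq0 (n%:Z - j - 1)); rewrite NR rmorphB rmorphB /=; ring.
rewrite -[X in _ --> X]addr0.
apply: cvgD; last exact: nbhs_dnbhs.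
apply: cvgB; [apply: cvgN|]; apply: cvgM.
- apply: cvgM; first by apply: (affine_cvg (k := -2)) => t; ring.
  by apply: (affine_cvg (k := -2)) => t; ring.
- apply: cvgV; first by rewrite mulf_neq0.
  by apply: (affine_cvg (k := 4)) => t; ring.
- by apply: (affine_cvg (k := -2 * n%:R)) => t; ring.
- apply: cvgV; first by rewrite mulf_neq0.
  by apply: (affine_cvg (k := 4)) => t; ring.
Qed.

End ParaKrawtchoukLimits.

(* The scalars form a field K containing the reals through a continuous
   embedding iota (K = R with the identity, or K = R[i]). *)
Theorem proposition4 (R : realType) (K : numFieldType)
    (iota : {rmorphism R -> K}) (iota_cont : continuous iota)
    (Delta : R) (Delta_lt0 : Delta < 0)
    (N : nat) (j : int) (p : nat) (p01 : p = 0%N \/ p = 1%N)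
    (Njp : N%:Z = 2 * j + p%:Z) (gamma : R)
    (V : R -> lmodType K) (e : forall t : R, nat -> V t)
    (calX calZ : forall t : R, {linear V t -> V t})
    (a b c u v w : R -> nat -> K)
    (e_basis : \forall t \near (0 : R)^', is_basis (e t))
    (calXZ : \forall t \near (0 : R)^', forall x : V t,
       calZ t (calX t x) - calX t (calZ t x)
         = calZ t (calZ t x) + iota Delta *: x)
    (X_tridiag : \forall t \near (0 : R)^',
       tridiagonal (e t) (fun x => iota (Omega Delta) *: calX t x)
         (a t) (b t) (c t))
    (Z_tridiag : \forall t \near (0 : R)^',
       tridiagonal (e t) (fun x => iota (Omega Delta) *: calZ t x)
         (w t) (v t) (u t))
    (phi0E : \forall t \near (0 : R)^',
       phi0 (c t) (u t) + 1 = iota (- j%:~R + t))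
    (delta0E : \forall t \near (0 : R)^',
       - delta0 (a t) (w t) = iota (- j%:~R + t + 1 - p%:R))
    (v0E : \forall t \near (0 : R)^',
       v t 0%N = iota ((gamma + p%:R - 1)
                       / (- 2 * j%:~R + 2 * t - p%:R + 1)))
    (btilde0E : \forall t \near (0 : R)^',
       btilde0 (a t) (b t) (c t) (u t) (v t) (w t)
         = iota (2^-1 * (N%:R + gamma - 1))) :
  [/\ forall n, (1 <= n <= N)%N -> cvg (a t n.-1 * c t n @[t --> (0 : R)^']),
      forall n, (n <= N)%N -> cvg (b t n @[t --> (0 : R)^']) &
      forall n, (n <= N)%N ->
        monic_ttr (fun m => lim (b t m @[t --> (0 : R)^']))
                  (fun m => lim (a t m.-1 * c t m @[t --> (0 : R)^'])) n
        = map_poly iota (paraKrawtchouk N p gamma n)].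
Proof.
have NJ : N%:R = 2 * j%:~R + p%:R :> R.
  by have /(congr1 (fun z : int => z%:~R : R)) := Njp; rewrite rmorphD rmorphM.
have iotaE := (rmorph_nat iota, rmorph1 iota, fmorphV iota, rmorphB iota,
               rmorphD iota, rmorphM iota, rmorphN iota).
have closed : \forall t \near (0 : R)^',
    (forall n, a t n * c t n.+1
       = iota (paraK_U_at (N%:R - 2 * t) p gamma n.+1)) /\
    (forall n, b t n = iota (paraK_B_at (N%:R - 2 * t) p gamma n + t)).
  near=> t.
  (* The closed forms are used over [K] with [D = iota (N - 2 t)]; injectivity of [iota] carries
     non-integrality over from the reals. *)
  have D_nint (k : int) : iota (N%:R - 2 * t) != k%:~R.
    rewrite -(rmorph_int iota) fmorph_eq.
    by move: k; near: t; exact: near0_shift_nint.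
  have basis : is_basis (e t) by near: t; exact: e_basis.
  have rel : forall x, calZ t (calX t x) - calX t (calZ t x)
         = calZ t (calZ t x) + iota Delta *: x by near: t; exact: calXZ.
  have Xt : tridiagonal (e t) (fun x => iota (Omega Delta) *: calX t x)
         (a t) (b t) (c t) by near: t; exact: X_tridiag.
  have Zt : tridiagonal (e t) (fun x => iota (Omega Delta) *: calZ t x)
         (w t) (v t) (u t) by near: t; exact: Z_tridiag.
  have phiE : phi0 (c t) (u t) + 1 = iota (- j%:~R + t) by near: t; exact: phi0E.
  have deltaE : - delta0 (a t) (w t) = iota (- j%:~R + t + 1 - p%:R).
    by near: t; exact: delta0E.
  have vE : v t 0%N = iota ((gamma + p%:R - 1)
                       / (- 2 * j%:~R + 2 * t - p%:R + 1)) by near: t; exact: v0E.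
  have bE : btilde0 (a t) (b t) (c t) (u t) (v t) (w t)
         = iota (2^-1 * (N%:R + gamma - 1)) by near: t; exact: btilde0E.
  have XZ x : (iota (Omega Delta) \*: calZ t) ((iota (Omega Delta) \*: calX t) x)
      - (iota (Omega Delta) \*: calX t) ((iota (Omega Delta) \*: calZ t) x)
      = (iota (Omega Delta) \*: calZ t) ((iota (Omega Delta) \*: calZ t) x) - x.
    rewrite /= !linearZ /= !scalerA -scalerDr rel scalerDr scalerA.
    rewrite -!rmorphM -expr2 (Omega_sqr Delta_lt0) rmorphN1 scaleN1r.
    by [].
  have [] := @tridiagonal_closed_form _ _ D_nint _ _
    (iota (Omega Delta) \*: calX t) (iota (Omega Delta) \*: calZ t)
    _ _ _ _ _ _ basis XZ Xt Zt p (iota gamma) (iota j%:~R) (iota t) p01.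
  - by rewrite NJ !iotaE.
  - by rewrite phiE !iotaE.
  - by rewrite deltaE !iotaE.
  - by rewrite vE !iotaE.
  - by rewrite bE NJ !iotaE.
  move=> UE BE; split=> n; first by rewrite UE rmorph_paraK_U.
  by rewrite BE -rmorph_paraK_B -rmorphD.
(* Limits are computed over the reals and moved to [K] by continuity of [iota]; agreement near 0 is
   enough. *)
have iota_cvg (h : R -> K) (f : R -> R) (l : R) :
    (\forall t \near (0 : R)^', h t = iota (f t)) ->
    f t @[t --> (0 : R)^'] --> l -> h t @[t --> (0 : R)^'] --> iota l.
  move=> hf fl; have hl := cvg_comp _ _ fl (@iota_cont l).
  apply: cvg_trans hl; apply: near_eq_cvg.
  by apply: filterS hf => t /= ->.
have U_cvg n : a t n * c t n.+1 @[t --> (0 : R)^']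
    --> iota (paraK_U N p gamma n.+1).
  apply: iota_cvg (@paraK_U_cvg _ _ _ _ Njp gamma _).
  by apply: filterS closed => t [-> _].
have B_cvg n : b t n @[t --> (0 : R)^'] --> iota (paraK_B N p gamma n).
  apply: iota_cvg (@paraK_B_cvg _ _ _ _ Njp gamma _).
  by apply: filterS closed => t [_ ->].
split=> [[|n] // _|n _|n nN].
- exact: cvgP (U_cvg n).
- exact: cvgP (B_cvg n).
(* Only [u m] with [m > 0] is compared, so [U_cvg], stated at successors, suffices. *)
rewrite map_monic_ttr; apply: eq_monic_ttr => [m _|[|m] // _].
- exact/cvg_lim/B_cvg.
- exact/cvg_lim/U_cvg.
Unshelve. all: by end_near.
Qed.
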